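(* Let $n\ge1$ and let $h_n\in\mathbb Z[X_1,\dots,X_n]$ be the polynomial defined in the context. Let $f=X^n+a_1X^{n-1}+\cdots+a_n\in\mathbb F_q[X]$ be irreducible. If $h_n(a_1,\dots,a_n)\ne0$, then $f$ is normal over $\mathbb F_q$, i.e., its roots are linearly independent over $\mathbb F_q$.
   Context: For $m\ge1$ let $\epsilon_m=e^{2\pi\sqrt{-1}/m}$ and $\Psi_m(X_0,\dots,X_{m-1})=\prod_{i\in(\mathbb Z/m\mathbb Z)^\times}\bigl(\sum_{j\in\mathbb Z/m\mathbb Z}\epsilon_m^{ij}X_j\bigr)$, which lies in $\mathbb Z[X_0,\dots,X_{m-1}]$. Let $S_m$ act on polynomials in $X_0,\dots,X_{m-1}$ by $\sigma(X_j)=X_{\sigma(j)}$, let $\mathrm{Stab}(\Psi_m)$ be the stabilizer of $\Psi_m$, let $\mathcal C_m$ be a system of representatives of the left cosets of $\mathrm{Stab}(\Psi_m)$ in $S_m$, and set $\Phi_m=\prod_{\sigma\in\mathcal C_m}\sigma(\Psi_m)$ (a symmetric polynomial in $\mathbb Z[X_0,\dots,X_{m-1}]$, independent of the choice of $\mathcal C_m$). For $m\mid n$, let $\mathcal P_{n,m}$ be the set of unordered partitions of $\{0,1,\dots,n-1\}$ into $m$ parts $P_0,\dots,P_{m-1}$ each of size $n/m$, and define \[ \Theta_{n,m}(X_0,\dots,X_{n-1})=\prod_{\{P_0,\dots,P_{m-1}\}\in\mathcal P_{n,m}}\Phi_m\Bigl(\sum_{a\in P_0}X_a,\dots,\sum_{a\in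 P_{m-1}}X_a\Bigr) \] (well defined since $\Phi_m$ is symmetric). $\Theta_{n,m}$ is a symmetric polynomial in $\mathbb Z[X_0,\dots,X_{n-1}]$, so there is a unique $\theta_{n,m}\in\mathbb Z[X_1,\dots,X_n]$ with $\Theta_{n,m}(X_0,\dots,X_{n-1})=\theta_{n,m}(s_1,\dots,s_n)$, where $s_i$ is the $i$-th elementary symmetric polynomial in $X_0,\dots,X_{n-1}$. Finally $h_n=\prod_{m\mid n}\theta_{n,m}$. *)

(* Defs.v *)
From HB Require Import structures.
From mathcomp Require Import all_boot all_order all_algebra all_fingroup all_field.
From mathcomp Require Import mpoly.
From Stdlib Require Import ClassicalEpsilon.
Set Implicit Arguments. Unset Strict Implicit. Unset Printing Implicit Defensive.
Import GRing.Theory.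
Local Open Scope ring_scope.

(* A fixed primitive m-th root of unity in algC (stands for e^{2 pi i/m};
   Psi_m does not depend on which primitive root is chosen). *)
Definition eps (m : nat) : algC :=
  match m with 0 => 1 | k.+1 => sval (C_prim_root_exists (ltn0Sn k)) end.

Definition PsiC (m : nat) : {mpoly algC[m]} :=
  \prod_(i < m | coprime i m) \sum_(j < m) (eps m ^+ (i * j)) *: 'X_j.

Definition PsiZ (m : nat) : {mpoly int[m]} :=
  epsilon (inhabits 0) (fun p : {mpoly int[m]} =>
    map_mpoly (fun z : int => z%:~R : algC) p = PsiC m).

(* Stab(Psi_m) in S_m, acting by sigma(X_j) = X_{sigma j} (msym). *)
Definition StabPsi (m : nat) : {set 'S_m} :=
  [set s : 'S_m | msym s (PsiZ m) == PsiZ m].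

(* Phi_m = prod over cosets sigma.Stab of sigma(Psi_m).  MathComp composes
   permutations left-to-right ((s * t) x = t (s x)), so the paper's left
   cosets sigma o Stab are MathComp's right cosets Stab :* sigma. *)
Definition PhiZ (m : nat) : {mpoly int[m]} :=
  \prod_(C in rcosets (StabPsi m) [set: 'S_m]) msym (repr C) (PsiZ m).

Definition part_nm (n m : nat) : {set {set {set 'I_n}}} :=
  [set P : {set {set 'I_n}} | [&& partition P [set: 'I_n], #|P| == m
                                 & [forall B in P, #|B| == (n %/ m)%N]]].

Definition ThetaZ (n m : nat) : {mpoly int[n]} :=
  \prod_(P in part_nm n m)
     (PhiZ m \mPo [tuple \sum_(a in nth set0 (enum P) k) 'X_a | k < m]).

(* theta_{n,m}: the (unique) t with t(s_1,...,s_n) = Theta_{n,m};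
   variable index i : 'I_n stands for X_{i+1}. *)
Definition thetaZ (n m : nat) : {mpoly int[n]} :=
  epsilon (inhabits 0) (fun t : {mpoly int[n]} =>
    t \mPo [tuple mesym n int i.+1 | i < n] = ThetaZ n m).

Definition hZ (n : nat) : {mpoly int[n]} :=
  \prod_(m <- divisors n) thetaZ n m.

(* Main.v *)
Require Import Defs.
From HB Require Import structures.
From mathcomp Require Import all_boot all_order all_algebra all_fingroup all_field.
From mathcomp Require Import all_solvable.
From mathcomp Require Import mpoly.
From Stdlib Require Import ClassicalEpsilon.
Set Implicit Arguments. Unset Strict Implicit. Unset Printing Implicit Defensive.
Import GRing.Theory.
Local Open Scope ring_scope.

(** Suppose that the roots [x^(q^i)], [i < n], of [f] are linearly dependent.
    The polynomials [g] over F_q with [\sum_i g_i x^(q^i) = 0] form an ideal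
    that contains ['X^n - 1] and a nonzero polynomial of degree less than [n],
    hence a proper divisor [D] of ['X^n - 1].  A root [e] of the cofactor
    of [D] then satisfies [\sum_(i < n) e^-i x^(q^i) = 0].  Let [m] be the
    order of [e]; grouping the indices by their residues modulo [m] makes one
    linear factor of the reduction of Psi_m vanish at the sums of roots over the
    residue classes, so Theta_(n, m), and therefore [h_n], vanishes.

    Psi_m can be computed with any primitive [m]-th root of unity of any
    field: each coefficient of the universal product
    [\prod_i \sum_j T^(ij) X_j] over Z[T] is congruent to an integer modulo
    the cyclotomic polynomial ['Phi_m]. *)

(** * Evaluation of integer polynomials in a commutative ring *)

Lemma map_mpoly_mmap n (R S : comNzRingType) (f : {rmorphism R -> S})
  (v : 'I_n -> S) (p : {mpoly R[n]}) : (map_mpoly f p).@[v] = mmap f v p.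
Proof.
rewrite /map_mpoly /mmap raddf_sum /=; apply: eq_bigr => m _.
by rewrite mmap1_id mul_mpolyC mevalZ mevalX.
Qed.

Lemma rmorph_mmap n (R S T : comNzRingType) (f : {rmorphism R -> S})
  (g : {rmorphism S -> T}) (v : 'I_n -> S) (p : {mpoly R[n]}) :
  g (mmap f v p) = mmap (g \o f) (g \o v) p.
Proof.
rewrite /mmap rmorph_sum; apply: eq_bigr => m _.
rewrite rmorphM rmorph_prod; congr (_ * _).
by apply: eq_bigr => i _; rewrite rmorphXn.
Qed.

Lemma mmap_intr_comp n m (S : comNzRingType) (v : 'I_n -> S)
  (p : {mpoly int[m]}) (t : m.-tuple {mpoly int[n]}) :
  mmap intr v (p \mPo t) = mmap intr (fun i => mmap intr v (tnth t i)) p.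
Proof.
rewrite comp_mpolyE [RHS]/mmap raddf_sum; apply: eq_bigr => d _ /=.
rewrite mmapZ rmorph_prod; congr (_ * _).
by apply: eq_bigr => i _; rewrite rmorphXn.
Qed.

Lemma mmap_intr_msym n (S : comNzRingType) (v : 'I_n -> S) (s : 'S_n)
  (p : {mpoly int[n]}) : mmap intr v (msym s p) = mmap intr (v \o s) p.
Proof.
rewrite /msym {2}/mmap raddf_sum [RHS]/mmap; apply: eq_bigr => d _ /=.
rewrite mul_mpolyC mmapZ rmorph_prod; congr (_ * _); apply: eq_bigr => i _ /=.
by rewrite rmorphXn /= mmapX mmap1U.
Qed.

Lemma eq_mmap n (R S : nzRingType) (f g : R -> S) (u v : 'I_n -> S) :
  f =1 g -> u =1 v -> mmap f u =1 mmap g v.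
Proof.
move=> fg uv p; rewrite /mmap; apply: eq_bigr => m _.
by rewrite fg (mmap1_eq _ uv).
Qed.

(** * Psi_m over an arbitrary field *)

(** The formula of [PsiC] with the root of unity as a parameter: [w = 'X] gives the universal form
    over Z[T], which specializes to every field. *)
Definition cyclotomic_norm_form (R : comNzRingType) (m : nat) (w : R) :
    {mpoly R[m]} :=
  \prod_(i < m | coprime i m) \sum_(j < m) (w ^+ (i * j)) *: 'X_j.

Lemma map_cyclotomic_norm_form (R S : comNzRingType) (g : {rmorphism R -> S})
  m (w : R) :
  map_mpoly g (cyclotomic_norm_form m w) = cyclotomic_norm_form m (g w).
Proof.
rewrite rmorph_prod; apply: eq_bigr => i _; rewrite rmorph_sum.
by apply: eq_bigr => j _; rewrite /= map_mpolyZ map_mpolyX rmorphXn.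
Qed.

(** Multiplication by [k] permutes the units modulo [m], and powers of [w] depend only on exponents
    modulo [m], so the factors are merely reordered. *)
Lemma cyclotomic_norm_form_exp (R : comNzRingType) m k (w : R) :
  w ^+ m = 1 -> coprime k m ->
  cyclotomic_norm_form m (w ^+ k) = cyclotomic_norm_form m w.
Proof.
case: m => [|m] wm cokm; first by rewrite /cyclotomic_norm_form !big_ord0.
pose h (i : 'I_m.+1) : 'I_m.+1 := inord (k * i %% m.+1).
have hE i : h i = (k * i %% m.+1)%N :> nat.
  by rewrite /h inordK // ltn_pmod.
have h_inj : injective h.
  move=> i j /(congr1 val) /=; rewrite !hE => /eqP.
  wlog le_ij : i j / (i <= j)%N => [hw|].
    by case/orP: (leq_total i j) => ?; [|rewrite eq_sym => /hw->]; auto.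
  rewrite eq_sym eqn_mod_dvd ?leq_mul2l ?le_ij ?orbT // -mulnBr.
  rewrite Gauss_dvdr 1?coprime_sym // => /dvdn_leq hle.
  apply/val_inj/eqP; rewrite eqn_leq le_ij /= -subn_eq0 -leqn0 leqNgt.
  apply/negP => /hle; rewrite leqNgt ltnS.
  by rewrite (leq_trans (leq_subr _ _)) // -ltnS.
rewrite [RHS]/cyclotomic_norm_form (reindex_inj h_inj) /=.
apply: eq_big => [i|i _].
  by rewrite hE coprime_modl coprimeMl cokm.
apply: eq_bigr => j _; congr (_ *: _); rewrite hE.
by rewrite -exprM mulnA !(exprM _ _ j) expr_mod.
Qed.

(** Valid in every characteristic: [w] is a root of ['X^m - 1], hence of some ['Phi_d] with d | m;
    then w^d = 1 forces m | d, so d = m. *)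
Lemma Cyclotomic_prim_root (K : fieldType) m (w : K) :
  m.-primitive_root w -> (map_poly intr 'Phi_m).[w] = 0.
Proof.
move=> prim_w; have m_gt0 := prim_order_gt0 prim_w.
have /(congr1 (fun p => (map_poly (intr : int -> K) p).[w])) := prod_Cyclotomic m_gt0.
rewrite rmorphB rmorphXn /= map_polyX rmorph1 !hornerE prim_expr_order // subrr.
move/eqP; rewrite rmorph_prod horner_prod prodf_seq_eq0 => /hasP[d d_m /= /eqP d0].
have d_gt0 : (0 < d)%N by move: d_m; rewrite -dvdn_divisors // => /dvdn_gt0->.
have /(congr1 (fun p => (map_poly (intr : int -> K) p).[w])) := prod_Cyclotomic d_gt0.
rewrite (bigD1_seq d) ?divisors_uniq -?dvdn_divisors //=.
rewrite rmorphM hornerM d0 mul0r rmorphB rmorphXn /= map_polyX rmorph1 !hornerE.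
move/esym/eqP; rewrite subr_eq0 -(prim_order_dvd prim_w) => m_d.
by rewrite (_ : m = d) //; apply/eqP; rewrite eqn_dvd m_d dvdn_divisors.
Qed.

(* A remainder modulo 'Phi_m of degree < phi(m) that takes the same value at
   all phi(m) primitive roots of unity is constant, hence an integer. *)
Lemma Cyclotomic_const_mod m (c : {poly int}) (z : algC) :
  m.-primitive_root z ->
  (forall k, coprime k m ->
     (map_poly intr c).[z ^+ k] = (map_poly intr c).[z] :> algC) ->
  exists a : int, exists q, c = q * 'Phi_m + a%:P.
Proof.
move=> prim_z c_inv.
have monPhi := Cyclotomic_monic m.
pose q := Pdiv.Ring.rdivp c 'Phi_m; pose r := Pdiv.Ring.rmodp c 'Phi_m.
have Dc : c = q * 'Phi_m + r by exact: Pdiv.RingMonic.rdivp_eq.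
have sz_r : (size r <= totient m)%N.
  have := Pdiv.Ring.ltn_rmodpN0 c (monic_neq0 monPhi).
  by rewrite size_Cyclotomic ltnS.
pose toC := map_poly (intr : int -> algC).
have r_val k : coprime k m -> (toC r).[z ^+ k] = (toC c).[z].
  move=> co; rewrite -(c_inv _ co) Dc /toC rmorphD rmorphM /= hornerD hornerM.
  by rewrite (Cyclotomic_prim_root _) ?mulr0 ?add0r // prim_root_exp_coprime.
suff r0 : toC r = ((toC c).[z])%:P.
  exists r`_0, q; rewrite {1}Dc; congr (_ + _).
  apply: size1_polyC; have := size_polyC_leq1 (toC c).[z].
  by rewrite -r0 size_map_inj_poly //; apply: intr_inj.
apply/eqP; rewrite -subr_eq0; apply/eqP; move: r_val; set d := (toC c).[z] => r_val.
pose rs := [seq z ^+ (val i) | i <- enum [pred i : 'I_m | coprime i m]].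
apply: (roots_geq_poly_eq0 (rs := rs)).
- apply/allP => _ /mapP[i /[!mem_enum] coi ->].
  by rewrite /root !hornerE r_val // subrr.
- rewrite map_inj_in_uniq ?enum_uniq // => i j _ _ /eqP.
  by rewrite (eq_prim_root_expr prim_z) !modn_small ?ltn_ord // => /eqP /val_inj.
- rewrite size_map -cardE.
  have -> : #|[pred i : 'I_m | coprime i m]| = totient m.
    rewrite totient_count_coprime -sum1_card big_mkord.
    rewrite big_mkcond; apply: eq_bigr => i _ /=.
    by rewrite inE coprime_sym; case: coprime.
  have d_le : (size d%:P <= totient m)%N.
    by rewrite (leq_trans (size_polyC_leq1 _)) // totient_gt0 (prim_order_gt0 prim_z).
  rewrite (leq_trans (size_polyD _ _)) // geq_max size_polyN d_le andbT.
  exact: leq_trans (size_poly _ _) sz_r.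
Qed.

Lemma eps_prim_root m : (0 < m)%N -> m.-primitive_root (eps m).
Proof. by case: m => // m _; rewrite /eps; case: C_prim_root_exists. Qed.

(** The integer form is chosen before the field, so that the same polynomial, once identified over
    [algC], also computes Psi_m in positive characteristic. *)
Lemma cyclotomic_norm_form_int m : (0 < m)%N ->
  exists P : {mpoly int[m]}, forall (K : fieldType) (w : K),
    m.-primitive_root w -> map_mpoly intr P = cyclotomic_norm_form m w.
Proof.
move=> m_gt0; have prim_z := eps_prim_root m_gt0; set z := eps m in prim_z.
pose U : {mpoly {poly int}[m]} := cyclotomic_norm_form m 'X.
have ev (K : fieldType) (w : K) d :
    (cyclotomic_norm_form m w)@_d = (map_poly intr U@_d).[w].
  pose g : {rmorphism {poly int} -> K} := horner_eval w \o map_poly intr.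
  have {1}-> : w = g 'X by rewrite /= map_polyX /horner_eval hornerX.
  by rewrite -map_cyclotomic_norm_form mcoeff_map_mpoly.
have cst d : exists a : int, exists q, U@_d = q * 'Phi_m + a%:P.
  apply: (Cyclotomic_const_mod prim_z) => k co.
  by rewrite -!ev cyclotomic_norm_form_exp // prim_expr_order.
(* [cst] yields an integer for each [d] separately; the constant coefficient of the remainder
   selects it as a function of [d]. *)
pose a d := (Pdiv.Ring.rmodp U@_d 'Phi_m)`_0.
have aE d : exists q, U@_d = q * 'Phi_m + (a d)%:P.
  have [b [q Dq]] := cst d; exists q; rewrite Dq /a Dq; congr (_ + _%:P).
  rewrite Pdiv.RingMonic.rmodp_addl_mul_small ?coefC ?Cyclotomic_monic //.
  rewrite size_Cyclotomic ltnS (leq_trans (size_polyC_leq1 _)) //.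
  by rewrite totient_gt0.
exists (\sum_(d : 'X_{1..m < msize U}) (a d) *: 'X_[d]) => K w prim_w.
apply/mpolyP => d; rewrite mcoeff_map_mpoly ev.
case: (ltnP (mdeg d) (msize U)) => ltd.
  have [q ->] := aE d.
  rewrite (mcoeff_mpoly a) // rmorphD rmorphM /= hornerD hornerM.
  by rewrite Cyclotomic_prim_root // mulr0 add0r map_polyC hornerC.
rewrite [U@__]memN_msupp_eq0 ?msuppnP; last first.
  by apply: contraL ltd => /msize_mdeg_lt; rewrite -ltnNge.
rewrite raddf0 horner0 raddf_sum big1 ?raddf0 //= => -[e le_e] _ /=.
rewrite mcoeffZ mcoeffX; case: eqP => [eq_ed|]; last by rewrite mulr0.
by move: ltd; rewrite -eq_ed leqNgt le_e.
Qed.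

(** Since [int] embeds in [algC], the polynomial picked by [epsilon] must be the one of
    [cyclotomic_norm_form_int], whose image is known in every field. *)
Lemma PsiZ_map m (K : fieldType) (w : K) : (0 < m)%N ->
  m.-primitive_root w -> map_mpoly intr (PsiZ m) = cyclotomic_norm_form m w.
Proof.
move=> m_gt0 prim_w; have [P PE] := cyclotomic_norm_form_int m_gt0.
have PsiC_P : map_mpoly intr P = PsiC m :> {mpoly algC[m]}.
  by rewrite (PE _ _ (eps_prim_root m_gt0)).
have spec := epsilon_spec (inhabits 0)
  (fun p : {mpoly int[m]} => map_mpoly (fun z : int => z%:~R : algC) p = PsiC m)
  (ex_intro _ P PsiC_P).
suff -> : PsiZ m = P by exact: PE.
apply/mpolyP => d; apply: (@intr_inj algC).
have /(congr1 (mcoeff d)) := etrans spec (esym PsiC_P).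
by rewrite !(mcoeff_map_mpoly (intr : {additive int -> algC})).
Qed.

(** * Symmetry of Phi_m and Theta_(n, m) *)

Lemma StabPsi1 m : 1%g \in StabPsi m.
Proof. by rewrite inE msym1m. Qed.

(** The representative is [u * s] with [u] in the stabilizer, and [u] acts first. *)
Lemma msym_repr_rcoset m (s : 'S_m) :
  msym (repr (StabPsi m :* s)%g) (PsiZ m) = msym s (PsiZ m).
Proof.
have /mem_repr : s \in (StabPsi m :* s)%g by rewrite mem_rcoset mulgV StabPsi1.
rewrite mem_rcoset inE msymMm => /eqP /(congr1 (msym s)).
by rewrite -!msymMm mulVg mulg1.
Qed.

(** Right translation by [s] permutes the right cosets of the stabilizer, hence the factors. *)
Lemma PhiZ_sym m : PhiZ m \is symmetric.
Proof.
apply/issymP => s; rewrite /PhiZ rmorph_prod /=.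
pose h (C : {set 'S_m}) := (C :* s)%g.
have h_inj : injective h by apply: can_inj (rcosetK s).
rewrite [RHS](reindex_inj h_inj) /=; apply: eq_big => [C|C].
  apply/rcosetsP/rcosetsP => [[x _ ->]|[x _ hC]].
    by exists (x * s)%g; rewrite ?inE // /h -rcosetM.
  exists (x * s^-1)%g; rewrite ?inE //.
  by rewrite rcosetM -hC /h rcosetK.
case/rcosetsP=> x _ ->.
by rewrite /h -rcosetM !msym_repr_rcoset msymMm.
Qed.

(** The coset of [s] contributes to Phi_m a factor whose value at [v] is that of Psi_m at [v \o s].
    The arguments may thus be put in any convenient order. *)
Lemma mmap_PhiZ_eq0 m (K : fieldType) (v : 'I_m -> K) (s : 'S_m) :
  mmap intr (v \o s) (PsiZ m) = 0 -> mmap intr v (PhiZ m) = 0.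
Proof.
rewrite -mmap_intr_msym -msym_repr_rcoset => v0.
rewrite /PhiZ rmorph_prod /= (bigD1 (StabPsi m :* s)%g) /= ?v0 ?mul0r //.
by apply/rcosetsP; exists s; rewrite ?inE.
Qed.

Lemma comp_mpoly_perm n m (p : {mpoly int[m]})
    (t u : m.-tuple {mpoly int[n]}) :
  p \is symmetric -> perm_eq t u -> p \mPo t = p \mPo u.
Proof.
move=> /issymP sym_p /tuple_permP[s Dt]; rewrite -{2}(sym_p s) msym_mPo.
by congr (_ \mPo _); apply: val_inj.
Qed.

Lemma msym_comp_mpoly n m (p : {mpoly int[m]}) (t : m.-tuple {mpoly int[n]})
    (s : 'S_n) :
  msym s (p \mPo t) = p \mPo [tuple msym s (tnth t i) | i < m].
Proof.
rewrite !comp_mpolyE rmorph_sum; apply: eq_bigr => d _ /=.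
rewrite msymZ rmorph_prod; congr (_ *: _); apply: eq_bigr => i _.
by rewrite rmorphXn tnth_mktuple.
Qed.

Lemma msym_sumX n (s : 'S_n) (B : {set 'I_n}) :
  msym s (\sum_(a in B) 'X_a) = \sum_(a in s @: B) 'X_a :> {mpoly int[n]}.
Proof.
rewrite rmorph_sum big_imset /=; last by move=> ? ? _ _; apply: perm_inj.
by apply: eq_bigr => a _; rewrite /msym mmapX mmap1U.
Qed.

Lemma mktuple_nth_enum (T : finType) (S : eqType) m (P : {set T}) (x0 : T)
    (g : T -> S) :
  #|P| = m -> [tuple g (nth x0 (enum P) k) | k < m] = map g (enum P) :> seq S.
Proof.
move=> cardP; rewrite cardE in cardP.
rewrite -[in RHS](mkseq_nth x0 (enum P)) -map_comp cardP -val_enum_ord /=.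
by rewrite -map_comp.
Qed.

Lemma perm_enum_imset (T U : finType) (g : T -> U) (P : {set T}) :
  injective g -> perm_eq (enum (g @: P)) (map g (enum P)).
Proof.
move=> g_inj; apply: uniq_perm; rewrite ?enum_uniq ?map_inj_uniq ?enum_uniq //.
move=> x; rewrite mem_enum; apply/imsetP/mapP => -[y Py ->]; exists y => //.
  by rewrite mem_enum.
by rewrite -mem_enum.
Qed.

(** [s] permutes the partitions in [part_nm n m]. It may change the order in which [enum] lists the
    blocks, but Phi_m is symmetric. *)
Lemma ThetaZ_sym n m : ThetaZ n m \is symmetric.
Proof.
apply/issymP => s; rewrite /ThetaZ rmorph_prod /=.
pose h (P : {set {set 'I_n}}) := [set s @: (B : {set 'I_n}) | B in P].
have s_inj : injective (fun B : {set 'I_n} => s @: B).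
  by apply: imset_inj; apply: perm_inj.
have h_inj : injective h by apply: imset_inj.
have hT : s @: [set: 'I_n] = [set: 'I_n].
  by apply/eqP; rewrite eqEcard subsetT card_imset //=; apply: perm_inj.
rewrite [RHS](reindex_inj h_inj) /=; apply: eq_big => [P|P].
  rewrite !inE -[X in _ = [&& partition _ X, _ & _]]hT.
  rewrite imset_partition; last exact: perm_inj.
  rewrite card_imset //; congr [&& _, _ & _].
  apply/forall_inP/forall_inP => [hP _ /imsetP[B BP ->]|hP B BP].
    by rewrite card_imset ?hP //; apply: perm_inj.
  rewrite -(card_imset B (@perm_inj _ s)) hP //.
  by apply/imsetP; exists B.
rewrite inE => /and3P[_ /eqP cardP _].
rewrite msym_comp_mpoly; apply: comp_mpoly_perm; first exact: PhiZ_sym.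
pose S (B : {set 'I_n}) : {mpoly int[n]} := \sum_(a in B) 'X_a.
have -> : [tuple msym s (tnth [tuple S (nth set0 (enum P) k) | k < m] i) | i < m]
   = [tuple S (s @: nth set0 (enum P) k) | k < m].
  by apply: eq_from_tnth => k; rewrite !tnth_mktuple msym_sumX.
rewrite (mktuple_nth_enum _ (fun B : {set 'I_n} => S (s @: B))) //.
rewrite (mktuple_nth_enum _ S) ?card_imset //.
rewrite (map_comp S (fun B : {set 'I_n} => s @: B)) perm_map //.
by rewrite perm_sym; apply: perm_enum_imset.
Qed.

(** The fundamental theorem of symmetric polynomials makes the predicate given to [epsilon]
    satisfiable. *)
Lemma thetaZ_comp n m :
  thetaZ n m \mPo [tuple mesym n int i.+1 | i < n] = ThetaZ n m.
Proof.
have [t [Dt _]] := sym_fundamental (ThetaZ_sym n m).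
exact: (epsilon_spec (inhabits 0) (fun t : {mpoly int[n]} =>
    t \mPo [tuple mesym n int i.+1 | i < n] = ThetaZ n m) (ex_intro _ t Dt)).
Qed.

(** * Frobenius and linearized polynomials *)

(* [j] only witnesses that [K] has the characteristic of [F], which makes the
   [#|F|]-th power map a ring morphism. *)
Definition frobenius (F : finFieldType) (K : fieldType)
  (j : {rmorphism F -> K}) (x : K) : K := x ^+ #|F|.

Section Frobenius.

Variables (F : finFieldType) (K : fieldType) (j : {rmorphism F -> K}).

Lemma pchar_nat_card : [pchar K].-nat #|F|.
Proof.
have [p p_pr pcharFp] := finPcharP F.
have pF : p.-nat #|F|.
  by rewrite -cardsT; apply: abelem_pgroup (fin_ring_pchar_abelem pcharFp).
apply: sub_in_pnat pF => i _; rewrite inE => /eqP->.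
by rewrite (fmorph_pchar j).
Qed.

Local Notation frobenius := (frobenius j).

Lemma frobenius_is_additive : zmod_morphism frobenius.
Proof.
move=> x y; have fD := exprDn_pchar _ _ pchar_nat_card.
by apply/eqP; rewrite eq_sym subr_eq /frobenius -fD subrK.
Qed.

Lemma frobenius_is_multiplicative : monoid_morphism frobenius.
Proof. by split=> [|x y]; rewrite /frobenius ?expr1n ?exprMn. Qed.

HB.instance Definition _ :=
  GRing.isZmodMorphism.Build K K frobenius frobenius_is_additive.
HB.instance Definition _ :=
  GRing.isMonoidMorphism.Build K K frobenius frobenius_is_multiplicative.

Lemma frobenius_fix c : frobenius (j c) = j c.
Proof. by rewrite /frobenius -rmorphXn /= expf_card. Qed.

Variable b : nat -> K.
Hypothesis bS : forall i, b i.+1 = frobenius (b i).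

(** When [b i] is x^(q^i), this is the value at [x] of the linearized polynomial attached to [g].
    Coefficients in [K] are allowed so that multiples by cofactors defined only over [K] can be
    paired too. *)
Definition pairing (g : {poly K}) : K := \sum_(i < size g) g`_i * b i.

Lemma pairingE N (g : {poly K}) :
  (size g <= N)%N -> pairing g = \sum_(i < N) g`_i * b i.
Proof.
move=> le_gN; rewrite /pairing (big_ord_widen N (fun i => g`_i * b i)) //.
rewrite big_mkcond; apply: eq_bigr => i _; case: ltnP => // le_gi.
by rewrite nth_default // mul0r.
Qed.

Lemma pairing_is_linear : scalar pairing.
Proof.
move=> c g h; set N := maxn (size g) (size h).
have le_N : (size (c *: g + h)%R <= N)%N.
  rewrite (leq_trans (size_polyD _ _)) // geq_max leq_max leq_maxr andbT.
  by rewrite size_scale_leq.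
rewrite (pairingE le_N) (@pairingE N g) ?leq_maxl // (@pairingE N h) ?leq_maxr //.
rewrite mulr_sumr -big_split; apply: eq_bigr => i _ /=.
by rewrite coefD coefZ mulrDl mulrA.
Qed.

HB.instance Definition _ :=
  GRing.isLinear.Build K {poly K} K *%R pairing pairing_is_linear.

Lemma pairingXn k : pairing 'X^k = b k.
Proof.
rewrite (@pairingE k.+1) ?size_polyXn // big_ord_recr /= coefXn eqxx mul1r.
by rewrite big1 ?add0r // => i _; rewrite coefXn ltn_eqF ?mul0r.
Qed.

Lemma pairing_mulX (g : {poly F}) :
  pairing (map_poly j g * 'X) = frobenius (pairing (map_poly j g)).
Proof.
rewrite [in RHS](@pairingE (size g)) ?size_map_poly //.
rewrite (@pairingE (size g).+1); last first.
  by rewrite (leq_trans (size_polyMleq _ _)) // size_polyX addn2 size_map_poly.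
rewrite big_ord_recl coefMX mul0r add0r rmorph_sum; apply: eq_bigr => i _.
by rewrite rmorphM coefMX /= coef_map frobenius_fix bS.
Qed.

(** By K-linearity it is enough to take [h] a power of ['X]; there [pairing_mulX] applies
    repeatedly, since the product stays over [F]. *)
Lemma pairing_mul (g : {poly F}) (h : {poly K}) :
  pairing (map_poly j g) = 0 -> pairing (map_poly j g * h) = 0.
Proof.
move=> g0; rewrite -[h]coefK poly_def mulr_sumr linear_sum big1 //= => i _.
rewrite -scalerAr linearZ /= (_ : pairing _ = 0) ?mulr0 //.
elim: (val i) => [|k IHk]; first by rewrite mulr1.
rewrite exprSr mulrA -(map_polyXn j) -rmorphM pairing_mulX rmorphM /=.
by rewrite map_polyXn IHk rmorph0.
Qed.

End Frobenius.

(** * Linear relations and roots of unity *)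

Lemma annihilated_by_root_of_unity (F : finFieldType) (K : closedFieldType)
    (j : {rmorphism F -> K}) (b : nat -> K) n (c : 'I_n -> F) :
  (forall i, b i.+1 = b i ^+ #|F|) -> b n = b 0 ->
  (exists i, c i != 0) -> \sum_(i < n) j (c i) * b i = 0 ->
  exists m, exists2 w : K, m.-primitive_root w &
    (m %| n)%N /\ \sum_(i < n) w ^+ i * b i = 0.
Proof.
move=> bS bn [i0 ci0] c0.
have n_gt0 : (0 < n)%N by case: n i0 {c ci0 bn c0} => [[]|].
pose g : {poly F} := \poly_(i < n) c (insubd i0 i).
have gE (i : 'I_n) : g`_i = c i by rewrite coef_poly ltn_ord valKd.
have g_neq0 : g != 0.
  by apply: contraNneq ci0 => g0; rewrite -gE g0 coef0.
have sz_g : (size g <= n)%N by apply: size_poly.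
have Tg : pairing b (map_poly j g) = 0.
  rewrite (@pairingE _ b n) ?size_map_poly // -[RHS]c0.
  by apply: eq_bigr => i _; rewrite coef_map gE.
have TX : pairing b (map_poly j ('X^n - 1)) = 0.
  rewrite rmorphB /= map_polyXn rmorph1 linearB /= -(expr0 'X) !pairingXn.
  by rewrite bn subrr.
(* [D] is an associate of the gcd, written as a combination of [g] and ['X^n - 1], so [pairing_mul]
   makes it pair to zero. *)
have [u Du] := Bezoutp g ('X^n - 1); set D := _ + _ in Du.
have TD : pairing b (map_poly j D) = 0.
  rewrite /D (mulrC u.1) (mulrC u.2) rmorphD !rmorphM linearD /=.
  by rewrite !(pairing_mul bS) ?addr0.
have D_X : D %| 'X^n - 1 by rewrite (eqp_dvdl _ Du) dvdp_gcdr.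
have sz_D : (size D <= n)%N.
  by rewrite (eqp_size Du) (leq_trans (leq_gcdpl _ _)).
have [E DE] := dvdpP _ _ D_X.
have X_neq0 : 'X^n - 1 != 0 :> {poly F} by rewrite -size_poly_gt0 size_XnsubC.
(* The cofactor [E] is not constant, as [D] has degree less than [n]. *)
have /closed_rootP[e]: size (map_poly j E) != 1%N.
  rewrite size_map_poly; apply/negP => /eqP szE.
  have := size_XnsubC (1 : F) n_gt0; rewrite polyC1 DE.
  rewrite size_proper_mul ?szE; last first.
    by rewrite -lead_coefM -DE lead_coef_eq0.
  by move=> szD; move: sz_D; rewrite [size D]szD ltnn.
case/factor_theorem => E' DE'.
have en : e ^+ n = 1.
  have /(congr1 (fun p => (map_poly j p).[e])) := DE.
  rewrite rmorphB /= map_polyXn rmorph1 rmorphM /= DE' !hornerE subrr mulr0 mul0r.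
  by move/eqP; rewrite subr_eq0 => /eqP.
have e_neq0 : e != 0.
  by apply: contra_eq_neq en => ->; rewrite expr0n gtn_eqF // eq_sym oner_eq0.
(* [D * E'] is (X^n - e^n) / (X - e), whose coefficient at X^(n-1-i) is e^i. *)
have Te : \sum_(i < n) e ^+ i * b (n.-1 - i)%N = 0.
  have : pairing b (map_poly j D * E') = 0 by rewrite (pairing_mul bS).
  have -> : map_poly j D * E' = \sum_(i < n) 'X^(n.-1 - i) * e%:P ^+ i.
    apply: (mulfI (monic_neq0 (monicXsubC e))); rewrite -subrXX -polyC_exp en polyC1.
    have /(congr1 (map_poly j)) := DE.
    rewrite rmorphB /= map_polyXn rmorph1 => ->; rewrite rmorphM /= DE'.
    by rewrite [E' * _]mulrC -mulrA [E' * _]mulrC.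
  rewrite linear_sum => TS; rewrite -[RHS]TS; apply: eq_bigr => i _.
  by rewrite /= -polyC_exp [X in pairing b X]mulrC mul_polyC linearZ /= pairingXn.
have [m prim_e m_n] := prim_order_exists n_gt0 en.
(* The relation carries e^(n-1-i) in front of [b i]; dividing by e^(n-1) leaves e^-i. *)
exists m, e^-1.
  have m_gt0 := prim_order_gt0 prim_e.
  have -> : e^-1 = e ^+ m.-1.
    by apply: (mulfI e_neq0); rewrite mulfV // -exprS prednK ?prim_expr_order.
  by rewrite prim_root_exp_coprime // -[X in coprime _ X](prednK m_gt0) coprimenS.
split=> //; move: Te; rewrite (reindex_inj rev_ord_inj) /=.
move/(congr1 ( *%R (e ^- n.-1))); rewrite mulr0 mulr_sumr => Te.
rewrite -[RHS]Te; apply: eq_bigr => i _; rewrite mulrA.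
have le_i : (i <= n.-1)%N by rewrite -ltnS prednK.
have n_i : (n - i.+1)%N = (n.-1 - i)%N by rewrite -subn1 -subnDA add1n.
rewrite n_i subKn //; congr (_ * _).
rewrite -exprVn -[in e^-1 ^+ n.-1](subnK le_i) exprD mulrAC -exprMn.
by rewrite mulVf // expr1n mul1r.
Qed.

(** * The roots of f as one Frobenius orbit *)

(** The polynomial [g] whose roots are the Frobenius orbit of one root is fixed by Frobenius, so it
    descends to [F] and [f] divides it by irreducibility. Conversely the orbit consists of distinct
    roots of [f], so [g] divides [f]. *)
Lemma roots_frobenius_orbit (F : finFieldType) (L : fieldExtType F)
    (f : {poly F}) (r : seq L) :
  irreducible_poly f ->
  map_poly (in_alg L) f = \prod_(x <- r) ('X - x%:P) ->
  exists x : L, perm_eq r (traject (frobenius (in_alg L)) x (size r)) /\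
    iter (size r) (frobenius (in_alg L)) x = x.
Proof.
move=> irr_f Df; have [sz_f _] := irr_f.
have sz_r : (0 < size r)%N.
  by move: sz_f; rewrite -(size_map_poly (in_alg L)) Df size_prod_XsubC.
have [x r_x] : exists x, x \in r.
  by case: r sz_r {Df} => // x r _; exists x; rewrite mem_head.
(* Orbits require a finite type, which [finvect_type] puts on [L]. *)
pose L' : finType := finvect_type L.
pose phi : L' -> L' := frobenius (in_alg L).
have phi_inj : injective phi by apply: fmorph_inj.
pose o : seq L := fingraph.orbit phi x.
pose g : {poly L} := \prod_(y <- o) ('X - y%:P).
have fx : root (map_poly (in_alg L) f) x by rewrite Df root_prod_XsubC.
have oE : o = traject (frobenius (in_alg L)) x (fingraph.order phi x) by [].
have /polyOver1P[g0 Dg0] : g \is a polyOver 1%VS.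
  have phi_g : map_poly (frobenius (in_alg L)) g = g.
    rewrite /g rmorph_prod /=.
    under eq_bigr do rewrite map_polyXsubC.
    rewrite -(big_map (frobenius (in_alg L)) xpredT (fun y => 'X - y%:P)).
    apply: perm_big; have u_o : uniq o by apply: orbit_uniq.
    have u_po : uniq (map (frobenius (in_alg L)) o).
      by rewrite map_inj_uniq //; apply: phi_inj.
    apply: uniq_perm => //; apply: (uniq_min_size u_po _ _).2.
      by move=> _ /mapP[y oy ->]; apply: (@fingraph.mem_orbit L' phi x).
    by rewrite size_map.
  apply/polyOverP => i.
  rewrite (Fermat's_little_theorem 1%AS) dimv1 expn1.
  by rewrite -[X in X == _]/(frobenius (in_alg L) g`_i) -coef_map phi_g.
(* Otherwise [f] and [g0] would be coprime, yet they share the root [x]. *)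
have f_g0 : f %| g0.
  have := irreducible_poly_coprime g0 irr_f; case: dvdp => //= co.
  have := co; rewrite -(coprimep_map (in_alg L)) => /coprimep_root /(_ fx).
  rewrite -Dg0 => /negP[]; rewrite -/(root g x) root_prod_XsubC.
  exact: (@in_orbit L' phi x).
have g_f : g %| map_poly (in_alg L) f.
  apply: uniq_roots_dvdp; last by rewrite uniq_rootsE; apply: orbit_uniq.
  apply/allP => y; rewrite oE => /trajectP[i _ ->].
  elim: i => //= i IHi.
  have -> : map_poly (in_alg L) f
      = map_poly (frobenius (in_alg L)) (map_poly (in_alg L) f).
    apply/polyP => k; rewrite !coef_map /=.
    by rewrite -[X in _ = _ X]/(in_alg L f`_k) frobenius_fix.
  by rewrite fmorph_root.
have Dfg : \prod_(y <- r) ('X - y%:P) = g.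
  apply/eqP; rewrite -eqp_monic ?monic_prod_XsubC //.
  by rewrite -Df /eqp g_f andbT Dg0 dvdp_map.
have perm_ro : perm_eq r o by apply: prod_XsubC_eq.
have sz_ro : size r = fingraph.order phi x.
  by rewrite (perm_size perm_ro) -(size_orbit phi).
exists x; rewrite sz_ro -oE; split=> //.
exact: (@iter_order L' phi phi_inj x).
Qed.

(** * Evaluation of h_n at the coefficients of f *)

Lemma mmap_mesymN n (S : comNzRingType) (v : 'I_n -> S) k :
  mmap intr (fun i => - v i) (mesym n int k)
    = (-1) ^+ k * mmap intr v (mesym n int k).
Proof.
rewrite /mesym !rmorph_sum /= mulr_sumr; apply: eq_bigr => h /eqP hk.
rewrite !rmorph_prod /= -hk -prodrN; apply: eq_bigr => i _.
by rewrite !mmapX !mmap1U.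
Qed.

(** By Vieta, [a i] is (-1)^(i+1) s_(i+1)(t), which is s_(i+1)(-t) by homogeneity; hence the negated
    roots. *)
Lemma mmap_hZ_roots n (K : fieldType) (a : 'I_n -> K) (t : n.-tuple K) :
  'X^n + \sum_(i < n) (a i)%:P * 'X^(n - i.+1)
    = \prod_(x <- t) ('X - x%:P) ->
  mmap intr a (hZ n)
    = \prod_(m <- divisors n) mmap intr (fun i => - tnth t i) (ThetaZ n m).
Proof.
move=> Da; rewrite /hZ rmorph_prod; apply: eq_bigr => m _ /=.
rewrite -thetaZ_comp mmap_intr_comp; apply: eq_mmap => // i.
rewrite tnth_mktuple mmap_mesymN.
have lt_i : (i.+1 < n.+1)%N by rewrite ltnS.
have /= := mroots_coeff t (Ordinal lt_i).
rewrite -Da coefD coefXn coef_sum (bigD1 i) //= coefCM coefXn eqxx mulr1.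
rewrite ltn_eqF ?add0r; last by rewrite ltn_subrL (leq_trans _ (ltn_ord i)).
rewrite big1 ?addr0 => [->|k ki].
  congr (_ * _); rewrite /mesym !rmorph_sum; apply: eq_bigr => h _.
  by rewrite !rmorph_prod; apply: eq_bigr => j _; rewrite /= mmapX mmap1U mevalXU.
rewrite coefCM coefXn; case: eqP; rewrite ?mulr0 // => nk.
case/eqP: ki; apply: val_inj => /=.
have := congr1 (subn n) nk; rewrite !subKn ?ltn_ord //.
by case.
Qed.

(** * Vanishing of Theta_(n, m) *)

(** The residue classes are blocks on which w^i is constant for an m-th root of unity w. *)
Lemma residue_partition n m : (0 < n)%N -> (m %| n)%N ->
  let B (k : 'I_m) : {set 'I_n} := [set i : 'I_n | (i %% m)%N == k] in
  injective B /\ [set B k | k : 'I_m] \in part_nm n m.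
Proof.
move=> n_gt0 m_n B; have m_gt0 : (0 < m)%N by apply: dvdn_gt0 m_n.
have le_mn : (m <= n)%N by apply: dvdn_leq.
have B_neq0 (k : 'I_m) : B k != set0.
  apply/set0Pn; exists (widen_ord le_mn k).
  by rewrite inE /= modn_small.
have [|part_B B_inj] := @indexed_partition _ _ predT B _ (fun k _ => B_neq0 k).
  move=> k l _ _ ne_lk; rewrite -setI_eq0; apply/eqP/setP => i; rewrite !inE.
  apply/negP => /andP[/eqP ik /eqP il].
  by case/eqP: ne_lk; apply: val_inj; rewrite /= -il.
split=> [k l|]; first exact: B_inj.
have coverT : cover [set B k | k : 'I_m] = [set: 'I_n].
  apply/setP => i; rewrite cover_imset inE; apply/bigcupP.
  by exists (Ordinal (ltn_pmod i m_gt0)); rewrite ?inE.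
rewrite inE -{1}coverT part_B card_imset ?card_ord ?eqxx; last first.
  by move=> k l; apply: B_inj.
apply/forall_inP => _ /imsetP[k _ ->].
have lt_h (q : 'I_(n %/ m)) : (q * m + k < n)%N.
  rewrite -[X in (_ < X)%N](divnK m_n); apply: (@leq_trans (q.+1 * m)).
    by rewrite mulSn addnC ltn_add2r.
  by rewrite leq_mul2r ltn_ord orbT.
pose h (q : 'I_(n %/ m)) : 'I_n := Ordinal (lt_h q).
have h_inj : injective h.
  move=> q q' /(congr1 val) /= /eqP; rewrite eqn_add2r eqn_pmul2r //.
  by move/eqP/val_inj.
suff -> : B k = h @: setT by rewrite card_imset // cardsT card_ord.
apply/setP => i; rewrite inE; apply/eqP/imsetP => [ik|[q _ ->] /=].
  have lt_q : (i %/ m < n %/ m)%N by rewrite ltn_divLR // divnK.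
  by exists (Ordinal lt_q) => //; apply: val_inj; rewrite /= -ik -divn_eq.
by rewrite modnMDl modn_small.
Qed.

(** Grouping indices by residue turns the relation into sum_k w^k y_k = 0, where the y_k are the
    block sums: the factor i = 1 of Psi_m vanishes. *)
Lemma ThetaZ_eq0 n m (K : fieldType) (v : 'I_n -> K) (w : K) :
  (0 < n)%N -> (m %| n)%N -> m.-primitive_root w ->
  \sum_(i < n) w ^+ i * v i = 0 -> mmap intr v (ThetaZ n m) = 0.
Proof.
move=> n_gt0 m_n prim_w w0; have m_gt0 : (0 < m)%N by apply: dvdn_gt0 m_n.
have [] := residue_partition n_gt0 m_n; set B := fun k : 'I_m => _.
set P := [set B k | k : 'I_m] => /= B_inj part_P.
rewrite /ThetaZ rmorph_prod (bigD1 P) //= mmap_intr_comp.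
rewrite [X in X * _](_ : _ = 0) ?mul0r //.
have cardP : size (enum P) = m by rewrite -cardE card_imset ?card_ord.
(* [enum P] lists the residue classes in an unspecified order; [s] records it. *)
have /tuple_permP[s Ds] : perm_eq [tuple B k | k < m] (tcast cardP (in_tuple (enum P))).
  rewrite val_tcast /= perm_sym enumT -enum_setT.
  have -> : P = B @: [set: 'I_m].
    by apply/setP => C; apply/imsetP/imsetP => -[k _ ->]; exists k.
  exact: perm_enum_imset.
have Bs (k : 'I_m) : nth set0 (enum P) (s k) = B k.
  have := congr1 (fun q => nth set0 q k) Ds.
  by rewrite -!tnth_nth !tnth_mktuple (tnth_nth set0) val_tcast.
apply: (@mmap_PhiZ_eq0 _ _ _ s).
pose y (k : 'I_m) := \sum_(i in B k) v i.
rewrite (@eq_mmap _ _ _ _ intr _ y) //; last first.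
  move=> k /=; rewrite tnth_mktuple Bs rmorph_sum; apply: eq_bigr => i _.
  by rewrite /= mmapX mmap1U.
rewrite -map_mpoly_mmap (PsiZ_map m_gt0 prim_w) /cyclotomic_norm_form rmorph_prod.
(* The index is written 1 mod m so as to cover m = 1, where it is 0. *)
have co1 : coprime (1 %% m) m by rewrite coprime_modl coprime1n.
rewrite (bigD1 (Ordinal (ltn_pmod 1 m_gt0))) //=.
rewrite [X in X * _](_ : _ = 0) ?mul0r // rmorph_sum -[RHS]w0 /=.
rewrite [RHS](partition_big (fun i : 'I_n => Ordinal (ltn_pmod i m_gt0)) xpredT) //=.
apply: eq_bigr => k _; rewrite mevalZ mevalXU mulr_sumr; apply: eq_big => [i|i].
  by rewrite inE.
rewrite inE => /eqP ik; congr (_ * _).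
by rewrite exprM prim_expr_mod // expr1 -ik prim_expr_mod.
Qed.

Theorem theorem3p1 (n : nat) (F : finFieldType) (f : {poly F}) (a : 'I_n -> F) :
  (0 < n)%N ->
  f = 'X^n + \sum_(i < n) (a i)%:P * 'X^(n - i.+1) ->
  irreducible_poly f ->
  (map_mpoly (fun z : int => z%:~R : F) (hZ n)).@[a] != 0 ->
  forall (L : fieldExtType F) (r : seq L),
    map_poly (fun c : F => c%:A : L) f = \prod_(x <- r) ('X - x%:P) ->
    free r.
Proof.
move=> n_gt0 Df irr_f h_neq0 L r Dr.
have sz_f : size f = n.+1.
  rewrite Df size_polyDl size_polyXn // ltnS.
  apply: (leq_trans (size_sum _ _ _)); apply/bigmax_leqP => i _.
  apply: (leq_trans (size_polyMleq _ _)); rewrite size_polyXn addnS /=.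
  apply: (@leq_trans (1 + (n - i.+1))); first by rewrite leq_add2r size_polyC_leq1.
  by rewrite add1n ltn_subrL n_gt0.
have sz_r : size r = n.
  by apply: succn_inj; rewrite -sz_f -(size_map_poly (in_alg L)) Dr size_prod_XsubC.
have [x [perm_r iter_x]] := roots_frobenius_orbit irr_f Dr.
rewrite sz_r in perm_r iter_x; set phi := frobenius _ in perm_r iter_x.
rewrite (perm_free perm_r); apply/negPn/negP => not_free.
(* The root of unity need not lie in [L], so the relation is moved to an algebraic closure. *)
have [K [iota _]] := countable_algebraic_closure (finvect_type L).
pose j : {rmorphism F -> K} := (iota : {rmorphism L -> K}) \o in_alg L.
pose b i := iota (iter i phi x).
have bS i : b i.+1 = b i ^+ #|F| by rewrite /b /= /phi /frobenius rmorphXn.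
have bn : b n = b 0 by rewrite /b iter_x.
have szT : size (traject phi x n) == n by rewrite size_traject.
have [c c_neq0 c0] : exists2 c : 'I_n -> F, exists i, c i != 0
    & \sum_(i < n) j (c i) * b i = 0.
  apply: NNPP => no_c; case/negP: not_free; apply/(@freeP _ _ _ (Tuple szT)).
  move=> c c0 i; apply/eqP/negPn/negP => ci; case: no_c; exists c; first by exists i.
  have /(congr1 iota) := c0; rewrite rmorph0 rmorph_sum => iota_c0.
  rewrite -[RHS]iota_c0; apply: eq_bigr => k _ /=.
  rewrite (set_nth_default x) ?size_traject // nth_traject //.
  by rewrite /b -rmorphM mulr_algl.
have [m [w prim_w [m_n w0]]] := annihilated_by_root_of_unity bS bn c_neq0 c0.
case/eqP: h_neq0; apply: (fmorph_inj j); rewrite rmorph0.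
rewrite (map_mpoly_mmap intr) rmorph_mmap.
rewrite (@eq_mmap _ _ _ _ intr _ (j \o a)) => [|z|//]; last exact: rmorph_int.
pose t : n.-tuple K := map_tuple iota (Tuple szT).
rewrite (@mmap_hZ_roots _ _ _ t); last first.
  transitivity (map_poly j f).
    rewrite Df rmorphD /= map_polyXn rmorph_sum; congr (_ + _).
    by apply: eq_bigr => i _; rewrite rmorphM /= map_polyC map_polyXn.
  rewrite map_poly_comp [map_poly (in_alg L) f]Dr (perm_big _ perm_r).
  rewrite rmorph_prod big_map; apply: eq_bigr => y _; exact: map_polyXsubC.
rewrite (bigD1_seq m) ?divisors_uniq -?dvdn_divisors //=.
rewrite (ThetaZ_eq0 n_gt0 m_n prim_w) ?mul0r //.
(* The conjugates enter negated, which preserves the relation. *)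
rewrite -[RHS]oppr0 -[in RHS]w0 -sumrN; apply: eq_bigr => i _.
by rewrite mulrN tnth_map (tnth_nth x) nth_traject.
Qed.
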